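(* Let $R$ be a tolerance on a set $U$ satisfying the following condition (C): for any $R$-path $(a_0,\ldots,a_4)$ of length $4$, there exist $0\le i,j\le 4$ such that $|i-j|\ge 2$ and $a_i\,R\,a_j$. Then $\mathit{RS}$ is a complete lattice.
   Context: A tolerance on $U$ is a reflexive and symmetric binary relation $R$ on $U$; $R(x)=\{y\in U\mid x\,R\,y\}$. For $X\subseteq U$, $X^{\blacktriangledown}=\{x\in U\mid R(x)\subseteq X\}$ and $X^{\blacktriangle}=\{x\in U\mid R(x)\cap X\neq\emptyset\}$. $\mathit{RS}=\{(X^{\blacktriangledown},X^{\blacktriangle})\mid X\subseteq U\}$ is ordered coordinatewise by inclusion. An $R$-path is a sequence $a_0,a_1,\ldots,a_n$ of distinct elements of $U$ such that $a_i\,R\,a_{i+1}$ for all $0\le i\le n-1$; its length is $n$ (the number of elements minus one). *)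

(* Defs.v *)
From HB Require Import structures.
From Stdlib Require Import RelationClasses.
From mathcomp Require Import all_boot all_order all_algebra.
From mathcomp Require Import boolp classical_sets.

Set Implicit Arguments.
Unset Strict Implicit.
Unset Printing Implicit Defensive.

Import Order.TTheory.
Local Open Scope classical_set_scope.

Definition complete_lattice (d : Order.disp_t) (L : porderType d) : Prop :=
  forall A : set L, supremums A !=set0 /\ infimums A !=set0.

(* R(x) is the partial application R x, seen as an element of set U. *)
Definition tolerance (U : Type) (R : U -> set U) : Prop :=
  Reflexive R /\ Symmetric R.

Definition lower_approx (U : Type) (R : U -> set U) (X : set U) : set U :=
  [set x | R x `<=` X].

Definition upper_approx (U : Type) (R : U -> set U) (X : set U) : set U :=
  [set x | R x `&` X !=set0].

Definition RS (U : Type) (R : U -> set U) : set (set U * set U) :=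
  [set (lower_approx R X, upper_approx R X) | X in [set: set U]].

(* The elements of RS R as a type, ordered as a subset of the product poset
   set U *p set U, i.e. coordinatewise by inclusion (see roughset_leP). *)
Record roughset (U : Type) (R : U -> set U) := RoughSet {
  approx_pair : set U *p set U;
  approx_pairP : approx_pair \in RS R }.

HB.instance Definition _ (U : Type) (R : U -> set U) :=
  [isSub for @approx_pair U R].
HB.instance Definition _ (U : Type) (R : U -> set U) :=
  [Choice of roughset R by <:].
HB.instance Definition _ (U : Type) (R : U -> set U) :=
  [SubChoice_isSubPOrder of roughset R by <: with Order.Disp tt tt].

Lemma roughset_leP (U : Type) (R : U -> set U) (p q : roughset R) :
  (p <= q)%O <->
  ((approx_pair p).1 `<=` (approx_pair q).1) /\ ((approx_pair p).2 `<=` (approx_pair q).2).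
Proof.
rewrite -Order.le_val leEprod.
by split=> [/andP[/asboolP ? /asboolP ?]|[? ?]] //; apply/andP; split; apply/asboolP.
Qed.

(* a_0, ..., a_n is encoded as a function on 'I_n.+1, so n is the length. *)
Definition rpath (U : Type) (R : U -> set U) (n : nat) (a : 'I_n.+1 -> U) : Prop :=
  injective a /\
  forall i j : 'I_n.+1, j = i.+1 :> nat -> R (a i) (a j).

Definition condC (U : Type) (R : U -> set U) : Prop :=
  forall a : 'I_5 -> U, @rpath U R 4 a ->
    exists i j : 'I_5, (2 <= `|i - j|)%N /\ R (a i) (a j).

(* Main.v *)
(** The infimum of a family [(X_k)] is sought among the pairs
    [(A, upper C)] with [A] the intersection of the [lower X_k] and [C] that of
    the [lower (upper X_k)]: every set below all the [X_k] is contained in [C],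
    so it suffices to find [Z] inside [C] with [lower Z = A] and
    [upper Z = upper C].  We take [Z = C \ W].  Let [V = lower C \ upper A].
    Condition (C) says that there is no induced path with five vertices; it
    forces every element of [lower C \ A] that lies in [upper A] to have all
    its neighbours outside [upper A] in [V].  Let [T] be the set of those
    neighbours and [W] the union of [T] with a maximal independent subset of
    the elements of [V] not adjacent to [T].  Then [W] meets [R x] for every
    [x] in [lower C \ A], so [lower Z = A], while every element of [W] has
    a neighbour in [Z], so [upper Z = upper C]. *)
Require Import Defs.
From mathcomp Require Import all_boot all_order.
From mathcomp Require Import boolp classical_sets.

Set Implicit Arguments.
Unset Strict Implicit.
Unset Printing Implicit Defensive.

Local Open Scope classical_set_scope.

(** The supremum of [A] is obtained as the infimum of its upper bounds. *)
Lemma complete_lattice_infimums (d : Order.disp_t) (L : porderType d) :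
  (forall A : set L, infimums A !=set0) -> complete_lattice L.
Proof.
move=> inf A; split; last exact: inf.
have [g [lbg gub]] := inf (ubound A).
exists g; split; last exact: lbg.
by move=> a Aa; apply: gub => b ubb; apply: ubb.
Qed.

(** By Zorn: an element of [V] unrelated to all of a maximal independent [M] could be added to
    it. *)
Lemma maximal_independent (U : Type) (R : U -> set U) (V : set U) :
  tolerance R ->
  exists M : set U, [/\ M `<=` V,
    forall x y, M x -> M y -> R x y -> x = y &
    forall x, V x -> exists2 y, M y & R x y].
Proof.
move=> [reflR symR].
pose P (M : set U) := M `<=` V /\ forall x y, M x -> M y -> R x y -> x = y.
have [F FP totF|M [[MV Mind] Mmax]] := @Zorn_bigcup U P.
  split=> [x [X FX Xx]|x y [X FX Xx] [Y FY Yy]]; first exact: (FP X FX).1.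
  have [XY|YX] := totF X Y FX FY.
    by apply: (FP Y FY).2 => //; apply: XY.
  by apply: (FP X FX).2 => //; apply: YX.
exists M; split=> // x Vx; apply: contrapT => noy.
have nMx : ~ M x by move=> Mx; apply: noy; exists x.
apply: (Mmax (x |` M)).
  by split=> [y My|/(_ x) Mx]; [right|apply/nMx/Mx; left].
split=> [y [->|/MV]//|y z [->|My] [->|Mz] // yz].
- by case: noy; exists z.
- by case: noy; exists y => //; apply: symR.
- exact: Mind.
Qed.

(** Without chords the five vertices are distinct, since for any two of them some vertex is related
    to just one; so [condC] applies. *)
Lemma condC_induced_path (U : Type) (R : U -> set U) (a x y u z : U) :
  tolerance R -> condC R -> R a x -> R x y -> R y u -> R u z ->
  [\/ R a y, R a u | R a z] \/ [\/ R x u, R x z | R y z].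
Proof.
move=> [reflR symR] CR ax xy yu uz; apply: contrapT => nR.
have nay : ~ R a y by move=> ?; apply: nR; left; constructor 1.
have nau : ~ R a u by move=> ?; apply: nR; left; constructor 2.
have naz : ~ R a z by move=> ?; apply: nR; left; constructor 3.
have nxu : ~ R x u by move=> ?; apply: nR; right; constructor 1.
have nxz : ~ R x z by move=> ?; apply: nR; right; constructor 2.
have nyz : ~ R y z by move=> ?; apply: nR; right; constructor 3.
pose p (i : 'I_5) := nth a [:: a; x; y; u; z] i.
have [|i [j]] := CR p.
  split=> [i j|].
    have neq s t w : R s w -> ~ R t w -> s <> t.
      by move=> sw tw e; apply: tw; rewrite -e.
    have nax : a <> x by apply/nesym/(neq _ _ y).
    have nxy : x <> y by apply/nesym/(neq _ _ u).
    have nyu : y <> u by apply/nesym/(neq _ _ z).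
    have nuz : u <> z by apply: (neq _ _ y); [apply: symR|move/symR].
    have ay : a <> y by apply: (neq _ _ a) => // /symR.
    have au : a <> u by apply: (neq _ _ a) => // /symR.
    have az : a <> z by apply: (neq _ _ a) => // /symR.
    have xu : x <> u by apply: (neq _ _ x) => // /symR.
    have xz : x <> z by apply: (neq _ _ x) => // /symR.
    have yz : y <> z by apply: (neq _ _ y) => // /symR.
    rewrite /p; move: i j => [[|[|[|[|[|//]]]]] ?] [[|[|[|[|[|//]]]]] ?] /= e;
      first [exact: val_inj|by []|by move: (esym e)].
  by move=> [[|[|[|[|[|//]]]]] ?] [[|[|[|[|[|//]]]]] ?].
rewrite /p; move: i j => [[|[|[|[|[|//]]]]] ?] [[|[|[|[|[|//]]]]] ?] /= [// _ ?];
  by auto.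
Qed.

Section Approximations.
Variables (U : Type) (R : U -> set U).
Hypothesis tolR : tolerance R.
Local Notation lower := (lower_approx R).
Local Notation upper := (upper_approx R).

Lemma upper_approxS (X Y : set U) : X `<=` Y -> upper X `<=` upper Y.
Proof. by move=> XY x [y [xy Xy]]; exists y; split; last exact: XY. Qed.

Lemma lower_approx_sub (X : set U) : lower X `<=` X.
Proof. by move=> x; apply; exact: tolR.1. Qed.

Lemma upper_approx_subP (X Y : set U) : upper X `<=` Y <-> X `<=` lower Y.
Proof.
split=> [XY x Xx y xy|XY y [x [yx /XY]]]; last by apply; exact: tolR.2.
by apply: XY; exists x; split=> //; exact: tolR.2.
Qed.

(* [A] and [C] stand for the intersections of the [lower X_k] and of the
   [lower (upper X_k)]. *)
Lemma exists_approx_pair (A C : set U) :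
    condC R ->
    upper A `<=` C -> lower (upper C) `<=` C ->
    (forall x, R x `<=` upper A -> A x) ->
    (forall x, lower C x -> R x `<=` [set x] -> A x) ->
  exists Z : set U, [/\ Z `<=` C, lower Z = A & upper Z = upper C].
Proof.
have [reflR symR] := tolR => CR AC Cclosed Aclosed Aiso.
have AlC : A `<=` lower C by apply/upper_approx_subP.
pose V := lower C `\` upper A.
pose T := [set y | ~ upper A y /\
  exists2 x, (lower C x /\ ~ A x) & upper A x /\ R x y].
have TV : T `<=` V.
  move=> y [nAy [x [lCx nAx] [[a [xa Aa]] xy]]]; split=> // u yu.
  (* Otherwise [u] has a neighbour [z] with no neighbour in [C], and
     [a, x, y, u, z] is an induced path. *)
  apply: contrapT => nCu.
  have [z uz nCz] : exists2 z, R u z & ~ upper C z.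
    apply: contrapT => noz; apply/nCu/Cclosed => z uz.
    by apply: contrapT => nCz; apply: noz; exists z.
  have nzC c : C c -> ~ R c z.
    by move=> Cc cz; apply: nCz; exists c; split=> //; apply: symR.
  have Ca : C a by apply: lower_approx_sub; apply: AlC.
  have Cx : C x by apply: lower_approx_sub.
  have Cy : C y by apply: lCx.
  (* The chord [a y] would put [y] in [upper A], [a u] and [x u] would put [u] in [C], and the
     others would join [z] to [C]. *)
  case: (condC_induced_path tolR CR (symR _ _ xa) xy yu uz) => -[].
  - by move=> ay; apply: nAy; exists a; split=> //; apply: symR.
  - by move=> au; apply: nCu; apply: AlC au.
  - exact: nzC.
  - by move=> xu; apply: nCu; apply: lCx xu.
  - exact: nzC.
  - exact: nzC.
have [M [MV' Mind Mdom]] :=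
  maximal_independent (V `\` upper T) tolR.
pose W := T `|` M.
have WV : W `<=` V by move=> x [/TV|/MV'[]].
exists (C `\` W); split; first by move=> x [].
- apply/seteqP; split=> [x lZx|x Ax y xy]; last first.
    split; first exact: AlC xy.
    move=> /WV[_]; apply; exists x; split=> //; exact: symR.
  have lCx : lower C x by move=> y /lZx[].
  have nW y : R x y -> ~ W y by move=> /lZx[].
  apply: contrapT => nAx.
  have [Ax|nuAx] := pselect (upper A x).
    apply: (nAx); apply: Aclosed => y xy; apply: contrapT => nAy.
    by apply: (nW y xy); left; split=> //; exists x.
  have [[y [xy Ty]]|nTx] := pselect (upper T x).
    by apply: (nW y xy); left.
  have [//|y My xy] := Mdom x.
  by apply: (nW y xy); right.
- apply/seteqP; split; first by apply: upper_approxS => x [].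
  move=> u [c [uc Cc]].
  have [Wc|nWc] := pselect (W c); last by exists c.
  have [lCc nAc] := WV c Wc.
  have Cu : C u by apply: lCc; apply: symR.
  have [Wu|nWu] := pselect (W u); last by exists u; split.
  (* For [u] in [T], the [x] from the definition of [T] serves: it lies in [upper A], which [W]
     misses. *)
  case: (Wu) => [[_ [x [lCx nAx] [Ax xu]]]|Mu].
    exists x; split; first exact: symR.
    by split; [exact: lower_approx_sub|move=> /WV[]].
  have [lCu nAu] := WV u Wu.
  (* Otherwise [Aiso] would put [u] in [A], hence in [upper A]. *)
  have [v [uv vu]] : exists v, R u v /\ v <> u.
    apply: contrapT => nov; apply: nAu; exists u; split=> //.
    apply: Aiso => // v uv; apply: contrapT => vu; apply: nov; exists v; split=> //.
  (* [v] is not in [T] because [M] misses [upper T], nor in [M] by independence. *)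
  exists v; split=> //; split; first exact: lCu.
  case=> [Tv|Mv]; last by apply: vu; apply/esym/Mind.
  by have [_] := MV' u Mu; apply; exists v.
Qed.

Definition to_roughset (X : set U) : roughset R :=
  @RoughSet U R (lower X, upper X) (mem_set (imageT _ X)).

Lemma roughsetE (p : roughset R) : exists X, p = to_roughset X.
Proof.
case: p => p pRS; have [X _ XE] := set_mem pRS.
by exists X; apply: val_inj; rewrite /= -XE.
Qed.

Lemma le_to_roughset (X Y : set U) :
  (to_roughset X <= to_roughset Y)%O <->
  lower X `<=` lower Y /\ upper X `<=` upper Y.
Proof. exact: roughset_leP. Qed.

Lemma roughset_infimums (F : set (roughset R)) : condC R -> infimums F !=set0.
Proof.
move=> CR.
pose A := [set x | forall X, F (to_roughset X) -> lower X x].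
pose C := [set x | forall X, F (to_roughset X) -> lower (upper X) x].
have uC X : F (to_roughset X) -> upper C `<=` upper X.
  by move=> FX; apply/upper_approx_subP => x; apply.
have AX X : F (to_roughset X) -> upper A `<=` X.
  by move=> FX; apply/upper_approx_subP => x; apply.
have XuX X : X `<=` lower (upper X) by apply/upper_approx_subP.
have [|x xC X FX|x xA X FX y /xA|x lCx x1 X FX y /x1 ->|Z [ZC ZA ZuC]] :=
    @exists_approx_pair A C CR.
- by move=> x Ax X FX; apply: XuX; apply: AX Ax.
- by move=> y /xC; apply: uC.
- exact: AX.
(* Only [x] itself can witness that [x] is in [upper X]. *)
- have [z [/x1 -> //]] : upper X x by apply: (lower_approx_sub lCx) => //; exact: tolR.1.
exists (to_roughset Z); split.
  move=> p; have [X ->] := roughsetE p => FX; apply/le_to_roughset.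
  by rewrite ZA ZuC; split; [move=> x; apply|exact: uC].
move=> p; have [Y ->] := roughsetE p => Ylb; apply/le_to_roughset.
rewrite ZA ZuC; split=> [x Yx X FX|].
  by have /le_to_roughset[YX _] := Ylb _ FX; exact: YX.
(* [Y] lies in [C], because [upper Y] inside [upper X] means [Y] inside [lower (upper X)]. *)
apply: upper_approxS => y Yy X FX.
have /le_to_roughset[_ /(upper_approx_subP _ _).1] := Ylb _ FX; exact.
Qed.

End Approximations.

Theorem theorem4p12 (U : Type) (R : U -> set U)
  (tolR : tolerance R) (CR : condC R) :
  complete_lattice (roughset R).
Proof.
by apply: complete_lattice_infimums => F; apply: roughset_infimums.
Qed.
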